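(* For all integers $p\ge 0$ and $n\ge 1$, $$\sum_{k=0}^n\binom{n}{k}F_k^{4p+3}=\left(\frac{1}{\sqrt5}\right)^{4p+2}\Bigg(\sum_{t=0}^{p}\binom{4p+3}{2t}F_{4p-4t+3}\Big\{\sum_{j=1}^{n}q(n-1,j)\,L_{(4p-4t+3)j}+q(n-1,0)\Big\}-(-1)^n\sum_{t=0}^{p-1}\binom{4p+3}{2t+1}F_{4p-4t+1}\Big\{\sum_{j=1}^{n-1}s(n-1,j)\,L_{(4p-4t+1)j}+s(n-1,0)\Big\}+\binom{4p+3}{2p+1}F_{n}\Bigg).$$
   Context: $F_k$ and $L_k$ denote the Fibonacci and Lucas numbers: $F_0=0$, $F_1=1$, $L_0=2$, $L_1=1$, each satisfying $u_{k+2}=u_{k+1}+u_k$. For integers $n,c\ge 0$ define $$q(n,c)=\sum_{m=0}^n(-1)^m\binom{n+1}{2m+c+1},\qquad s(n,c)=(-1)^{n+c}\sum_{m=0}^n(-1)^m\binom{n+1}{2m+c+1},$$ where $\binom{N}{M}=0$ for $M>N\ge 0$. Empty sums are $0$. *)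

(* Defs.v *)
From mathcomp Require Import all_boot all_order all_algebra.

Set Implicit Arguments.
Unset Strict Implicit.
Unset Printing Implicit Defensive.

Import Order.TTheory GRing.Theory Num.Theory.

Local Open Scope ring_scope.

Fixpoint fib (n : nat) : nat :=
  match n with
  | 0 => 0
  | 1 => 1
  | (k.+1 as m).+1 => fib m + fib k
  end%N.

Fixpoint lucas (n : nat) : nat :=
  match n with
  | 0 => 2
  | 1 => 1
  | (k.+1 as m).+1 => lucas m + lucas k
  end%N.

Definition q (n c : nat) : int :=
  \sum_(0 <= m < n.+1) (-1) ^+ m * ('C(n + 1, 2 * m + c + 1))%:Z.

Definition s (n c : nat) : int :=
  (-1) ^+ (n + c) *
    \sum_(0 <= m < n.+1) (-1) ^+ m * ('C(n + 1, 2 * m + c + 1))%:Z.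

(* Main.v *)
(** Put [a, b = (1 ± √5)/2], so that [√5 F_k = a^k - b^k].  Expanding
    [(a^k - b^k)^N] with [N = 4p + 3] and pairing the terms [i] and [N - i]
    gives, since [a b = -1],
      [√5^N F_k^N = Σ_(i <= 2p+1) C(N,i) (-1)^(i+ik) (a^(km) - b^(km))],
    with [m = N - 2i] odd.  Summing over [k] yields the differences
    [(1 + x)^n - (1 + y)^n] with [x = ±a^m], [y = ±b^m], [x y = -1].  Such a
    difference is divisible by [x - y]: as [x^j (x - y) = x^(j+1) + x^(j-1)],
    the quotient has coefficients [c_j] on [x^j + y^j] subject to
    [c_j + c_(j+2) = C(n,j+1)], and the solution is [c_j = q (n-1) j].  For
    [m = 1] and odd [i], [1 - a = b] reduces the difference to [-√5 F_n]. *)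
Require Import Defs.
From mathcomp Require Import all_boot all_order all_algebra.
From mathcomp Require Import ring zify.

Set Implicit Arguments.
Unset Strict Implicit.
Unset Printing Implicit Defensive.

Import Order.TTheory GRing.Theory Num.Theory.

Local Open Scope ring_scope.

Lemma fibSS n : fib n.+2 = (fib n.+1 + fib n)%N.
Proof. by []. Qed.

Lemma lucasSS n : lucas n.+2 = (lucas n.+1 + lucas n)%N.
Proof. by []. Qed.

(** The two hypotheses make [a] and [b] roots of X^2 - X - 1 in any commutative ring; a square root
    of 5 enters only in the theorem. *)
Lemma golden_sqr (R : comNzRingType) (a b : R) : a + b = 1 -> a * b = -1 ->
  a * a = a + 1.
Proof.
move=> sab pab; have eb : b = 1 - a by rewrite -sab; ring.
by rewrite -[in RHS](opprK 1) -pab eb; ring.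
Qed.

Lemma fib_binet (R : comNzRingType) (a b : R) : a + b = 1 -> a * b = -1 ->
  forall n, (a - b) * (fib n)%:R = a ^+ n - b ^+ n.
Proof.
move=> sab pab n.
suff [] : (a - b) * (fib n)%:R = a ^+ n - b ^+ n /\
  (a - b) * (fib n.+1)%:R = a ^+ n.+1 - b ^+ n.+1 by [].
elim: n => [|n [IH0 IH1]]; first by rewrite /= !expr0 !expr1; split; ring.
split=> //; rewrite fibSS natrD mulrDr IH1 IH0 !exprS.
have a2 := golden_sqr sab pab.
have b2 : b * b = b + 1 by apply: (@golden_sqr _ b a); rewrite 1?addrC 1?mulrC.
rewrite !mulrA a2 b2; ring.
Qed.

Lemma lucas_binet (R : comNzRingType) (a b : R) : a + b = 1 -> a * b = -1 ->
  forall n, (lucas n)%:R = a ^+ n + b ^+ n.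
Proof.
move=> sab pab n.
suff [] : (lucas n)%:R = a ^+ n + b ^+ n /\
  (lucas n.+1)%:R = a ^+ n.+1 + b ^+ n.+1 by [].
elim: n => [|n [IH0 IH1]]; first by rewrite /= !expr0 !expr1 sab; split; ring.
split=> //; rewrite lucasSS natrD IH1 IH0 !exprS.
have a2 := golden_sqr sab pab.
have b2 : b * b = b + 1 by apply: (@golden_sqr _ b a); rewrite 1?addrC 1?mulrC.
rewrite !mulrA a2 b2; ring.
Qed.

(** Term [m.+1] of [q n j] cancels term [m] of [q n j.+2]. Only the first term of [q n j] survives,
    as the last binomial of [q n j.+2] has lower index above [n.+1]. *)
Lemma q_recurrence n j : q n j + q n j.+2 = 'C(n.+1, j.+1)%:Z.
Proof.
rewrite /q !addn1 [X in X + _]big_nat_recl // [X in _ + X]big_nat_recr //=.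
rewrite [X in _ + (_ + _ * X%:Z)]bin_small; last by lia.
rewrite mulr0 addr0 muln0 add0n addn1 expr0 mul1r -addrA -big_split /=.
rewrite big1 ?addr0 // => m _.
have -> : (2 * m.+1 + j + 1 = 2 * m + j.+2 + 1)%N by lia.
by rewrite exprS; ring.
Qed.

Lemma q_eq0 n j : (n < j)%N -> q n j = 0.
Proof.
move=> ltnj; rewrite /q big1 // => m _.
by rewrite bin_small ?mulr0 //; lia.
Qed.

(** Summation by parts: the factor [D j.+1] collects [c j] from index [j] and [c j.+2] from index
    [j.+2]. This moves the three-term recurrence from the powers to the coefficients, up to boundary
    terms. *)
Lemma sumr_three_term (R : comNzRingType) (c D : nat -> R) n : D 0%N = 0 ->
  \sum_(1 <= j < n.+1) c j * (D j.+1 + D j.-1) + c 0%N * D 1%N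
    + c n.+1 * D n
  = \sum_(0 <= j < n) (c j + c j.+2) * D j.+1 + c n * D n.+1.
Proof.
move=> D0; elim: n => [|n IH]; first by rewrite !big_geq // D0; ring.
rewrite big_nat_recr // [in RHS]big_nat_recr //=.
by move/(canRL (addrK _))/(canRL (addrK _)): IH => ->; ring.
Qed.

Lemma expr1D_diff (R : comNzRingType) (x y : R) n : x * y = -1 ->
  (1 + x) ^+ n.+1 - (1 + y) ^+ n.+1 =
  (x - y) * (\sum_(1 <= j < n.+2) (q n j)%:~R * (x ^+ j + y ^+ j)
             + (q n 0)%:~R).
Proof.
move=> xy; have := @sumr_three_term _ (fun j => (q n j)%:~R)
  (fun j => x ^+ j - y ^+ j) n.+1 (subrr 1).
(* Both upper boundary terms carry a vanishing coefficient. *)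
rewrite (@q_eq0 n n.+1) // (@q_eq0 n n.+2) // !mul0r !addr0 !expr1 => key.
transitivity (\sum_(1 <= j < n.+2) (q n j)%:~R *
    (x ^+ j.+1 - y ^+ j.+1 + (x ^+ j.-1 - y ^+ j.-1)) + (q n 0)%:~R * (x - y)).
  (* The constant terms of the two binomial expansions cancel; the others match through
     [q_recurrence]. *)
  rewrite key !exprDn big_ord_recl [X in _ - X]big_ord_recl opprD addrACA.
  rewrite !expr0 subrr add0r -sumrB big_mkord; apply: eq_bigr => i _.
  rewrite -rmorphD q_recurrence /= !expr1n !mul1r -mulrnBl.
  by rewrite [RHS]mulrC -[LHS]mulr_natr.
rewrite [RHS]mulrDr mulr_sumr [in RHS](mulrC (x - y) _%:~R); congr (_ + _).
apply: eq_big_nat => -[//|j] _ /=.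
by rewrite !exprS; ring: xy.
Qed.

Lemma sumr_halves (V : nmodType) (f : nat -> V) h :
  \sum_(0 <= i < h.*2) f i = \sum_(0 <= i < h) (f i + f (h.*2 - i.+1)%N).
Proof.
rewrite big_split /= -addnn (big_cat_nat (n := h)) ?leq_addr //=.
congr (_ + _); rewrite big_nat_rev /= -{1}[h]add0n big_addn addnK.
by apply: eq_big_nat => i ltih; congr f; lia.
Qed.

Lemma sumr_parity (V : nmodType) (f : nat -> V) h :
  \sum_(0 <= i < h.*2) f i = \sum_(0 <= t < h) (f (2 * t)%N + f (2 * t + 1)%N).
Proof.
elim: h => [|h IH]; first by rewrite !big_geq.
by rewrite doubleS !big_nat_recr //= IH -addrA mul2n addn1.
Qed.

Lemma exprB_odd (R : comNzRingType) (x y : R) h :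
  (x - y) ^+ h.*2.+1 =
  \sum_(0 <= i < h.+1) 'C(h.*2.+1, i)%:R * (- (x * y)) ^+ i
     * (x ^+ (h.*2.+1 - 2 * i) - y ^+ (h.*2.+1 - 2 * i)).
Proof.
rewrite exprBn -(big_mkord xpredT (fun i =>
  (-1) ^+ i * x ^+ (h.*2.+1 - i) * y ^+ i *+ 'C(h.*2.+1, i))).
rewrite -doubleS sumr_halves; apply: eq_big_nat => i /andP[_ ltih].
have -> : (h.+1.*2 - i.+1 = h.*2.+1 - i)%N by lia.
rewrite bin_sub; last by lia.
rewrite subKn; last by lia.
(* The exponent is odd, so paired indices have opposite parity. *)
have odd_sub : (-1) ^+ (h.*2.+1 - i) = - (-1) ^+ i :> R.
  rewrite -signr_odd -[in RHS]signr_odd -signrN.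
  by congr (_ ^+ (nat_of_bool _)); lia.
(* This exposes the common factor [(x * y) ^+ i]. It also alters the exponent of the sign, so
   [odd_sub] is reapplied in the new form. *)
have -> : (h.*2.+1 - i = h.*2.+1 - 2 * i + i)%N by lia.
rewrite -[(-1) ^+ (_ + i)](_ : - (-1) ^+ i = _); last first.
  by rewrite -odd_sub; congr (_ ^+ _); lia.
rewrite -[X in X + _]mulr_natr -[X in _ + X]mulr_natr !exprD.
rewrite (exprNn (x * y)) exprMn.
ring.
Qed.

Lemma sum_bin_expr (R : comNzRingType) (z : R) n :
  \sum_(0 <= k < n.+1) 'C(n, k)%:R * z ^+ k = (1 + z) ^+ n.
Proof.
rewrite big_mkord exprDn; apply: eq_bigr => k _.
by rewrite expr1n mul1r mulr_natl.
Qed.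

Lemma sum_bin_exprB_odd (R : comNzRingType) (a b : R) n h : a * b = -1 ->
  \sum_(0 <= k < n.+1) 'C(n, k)%:R * (a ^+ k - b ^+ k) ^+ h.*2.+1 =
  \sum_(0 <= i < h.+1) 'C(h.*2.+1, i)%:R * (-1) ^+ i
     * ((1 + (-1) ^+ i * a ^+ (h.*2.+1 - 2 * i)) ^+ n
        - (1 + (-1) ^+ i * b ^+ (h.*2.+1 - 2 * i)) ^+ n).
Proof.
move=> pab.
under eq_bigr => k _ do rewrite exprB_odd big_distrr.
rewrite exchange_big /=; apply: eq_bigr => i _.
rewrite -!sum_bin_expr -sumrB big_distrr /=; apply: eq_bigr => k _.
(* The sign [(- (-1) ^+ k) ^+ i] splits into [(-1) ^+ i] and a [k]-th power, which joins the base of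
   the binomial sum. *)
rewrite -exprMn pab -[- (-1) ^+ k]mulN1r !exprMn.
by rewrite -!exprM [(k * i)%N]mulnC ![(k * (_ - _))%N]mulnC; ring.
Qed.

Lemma exprN1_odd (R : comNzRingType) (a b : R) m : a * b = -1 -> odd m ->
  a ^+ m * b ^+ m = -1.
Proof. by move=> pab oddm; rewrite -exprMn pab -signr_odd oddm. Qed.

Section BinetPair.

Variables (R : comNzRingType) (a b : R).
Hypotheses (sab : a + b = 1) (pab : a * b = -1).

Lemma expr1D_diff_lucas n m : odd m ->
  (1 + a ^+ m) ^+ n.+1 - (1 + b ^+ m) ^+ n.+1 =
  (a - b) * ((fib m)%:R *
    (\sum_(1 <= j < n.+2) (q n j)%:~R * (lucas (m * j))%:R + (q n 0)%:~R)).
Proof.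
move=> oddm; rewrite expr1D_diff ?exprN1_odd // mulrA fib_binet //.
congr (_ * (_ + _)); apply: eq_bigr => j _.
by rewrite (lucas_binet sab pab) !exprM.
Qed.

(** With x = -a^m and y = -b^m, the sign of x^j + y^j turns [q] into [s] up to (-1)^n; the sign of x
    - y supplies one more factor -1. *)
Lemma expr1B_diff_lucas n m : odd m ->
  (1 - a ^+ m) ^+ n.+1 - (1 - b ^+ m) ^+ n.+1 =
  (a - b) * ((-1) ^+ n.+1 * ((fib m)%:R *
    (\sum_(1 <= j < n.+1) (s n j)%:~R * (lucas (m * j))%:R + (s n 0)%:~R))).
Proof.
move=> oddm.
rewrite expr1D_diff; last by rewrite mulrNN exprN1_odd.
rewrite [(-1) ^+ _ * _]mulrCA [RHS]mulrA fib_binet // -opprD mulNr -mulrN.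
rewrite exprS mulN1r mulNr; congr (_ * - _).
have sE j : (-1) ^+ n * (s n j)%:~R = (-1) ^+ j * (q n j)%:~R :> R.
  rewrite /s -/(q n j) rmorphM rmorph_sign /= exprD !mulrA -expr2.
  by rewrite sqrr_sign mul1r.
(* The top coefficient is zero, hence the shorter range of the sum. *)
rewrite big_nat_recr //= (@q_eq0 n n.+1) // mul0r addr0.
rewrite mulrDr mulr_sumr sE mul1r; congr (_ + _); apply: eq_bigr => j _.
rewrite mulrA sE (lucas_binet sab pab) !(exprNn (_ ^+ m)) !exprM.
ring.
Qed.

Lemma sum_bin_fib_expr p n :
  (a - b) ^+ (4 * p + 3) *
    \sum_(0 <= k < n.+2) 'C(n.+1, k)%:R * (fib k)%:R ^+ (4 * p + 3) =
  (a - b) *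
    (\sum_(0 <= t < p.+1)
       'C(4 * p + 3, 2 * t)%:R * (fib (4 * p - 4 * t + 3))%:R *
       (\sum_(1 <= j < n.+2)
          (q n j)%:~R * (lucas ((4 * p - 4 * t + 3) * j))%:R + (q n 0)%:~R)
     - (-1) ^+ n.+1 *
       \sum_(0 <= t < p)
         'C(4 * p + 3, 2 * t + 1)%:R * (fib (4 * p - 4 * t + 1))%:R *
         (\sum_(1 <= j < n.+1)
            (s n j)%:~R * (lucas ((4 * p - 4 * t + 1) * j))%:R + (s n 0)%:~R)
     + 'C(4 * p + 3, 2 * p + 1)%:R * (fib n.+1)%:R).
Proof.
have key := sum_bin_exprB_odd n.+1 (2 * p + 1) pab.
rewrite (_ : (2 * p + 1).*2.+1 = 4 * p + 3)%N in key; last by lia.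
rewrite (_ : (2 * p + 1).+1 = p.+1.*2)%N in key; last by lia.
(* Even and odd [i] give the [q] and [s] sums; the last odd index, [2 * p + 1], is the case m = 1
   and is set apart. *)
rewrite sumr_parity big_split /= [X in _ + X]big_nat_recr //= in key.
transitivity (\sum_(0 <= k < n.+2)
    'C(n.+1, k)%:R * (a ^+ k - b ^+ k) ^+ (4 * p + 3)).
  rewrite mulr_sumr; apply: eq_bigr => k _.
  by rewrite -(fib_binet sab pab) exprMn mulrCA.
rewrite {}key addrA [RHS]mulrDr [X in _ = X + _]mulrDr mulrN; congr (_ + _ + _).
- rewrite mulr_sumr; apply: eq_big_nat => t /andP[_ ltt].
  rewrite exprM sqrrN expr1n expr1n !mul1r mulr1.
  rewrite (_ : 4 * p + 3 - 2 * (2 * t) = 4 * p - 4 * t + 3)%N; last by lia.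
  rewrite expr1D_diff_lucas; last by lia.
  ring.
- rewrite !mulr_sumr -sumrN; apply: eq_big_nat => t /andP[_ ltt].
  rewrite exprD exprM sqrrN expr1n expr1n expr1 !mul1r !mulN1r.
  rewrite (_ : 4 * p + 3 - 2 * (2 * t + 1) = 4 * p - 4 * t + 1)%N; last by lia.
  rewrite expr1B_diff_lucas; last by lia.
  ring.
- rewrite (_ : 4 * p + 3 - 2 * (2 * p + 1) = 1)%N; last by lia.
  rewrite !expr1 exprD exprM sqrrN expr1n expr1n expr1 !mul1r !mulN1r.
  have -> : 1 - a = b by rewrite -sab; ring.
  have -> : 1 - b = a by rewrite -sab; ring.
  by rewrite [RHS]mulrCA (fib_binet sab pab); ring.
Qed.

End BinetPair.

Theorem theorem4p2 (R : rcfType) (p n : nat) (hn : (1 <= n)%N) :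
  \sum_(0 <= k < n.+1) ('C(n, k))%:R * (fib k)%:R ^+ (4 * p + 3) =
  (1 / Num.sqrt 5) ^+ (4 * p + 2) *
    ( \sum_(0 <= t < p.+1)
        ('C(4 * p + 3, 2 * t))%:R * (fib (4 * p - 4 * t + 3))%:R *
        ( \sum_(1 <= j < n.+1)
            (q (n - 1) j)%:~R * (lucas ((4 * p - 4 * t + 3) * j))%:R
          + (q (n - 1) 0)%:~R )
      - (-1) ^+ n *
        \sum_(0 <= t < p)
          ('C(4 * p + 3, 2 * t + 1))%:R * (fib (4 * p - 4 * t + 1))%:R *
          ( \sum_(1 <= j < n)
              (s (n - 1) j)%:~R * (lucas ((4 * p - 4 * t + 1) * j))%:R
            + (s (n - 1) 0)%:~R )
      + ('C(4 * p + 3, 2 * p + 1))%:R * (fib n)%:R ) :> R.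
Proof.
case: n hn => // n _; rewrite subn1 succnK.
set d : R := Num.sqrt 5; set B := (X in _ * X).
have d2 : d ^+ 2 = 5 by rewrite sqr_sqrtr ?ler0n.
have d0 : d != 0 by rewrite sqrtr_eq0 -ltNge ltr0n.
pose a := (1 + d) / 2; pose b := (1 - d) / 2.
have sab : a + b = 1 by rewrite /a /b; field.
have pab : a * b = -1.
  by apply: (mulfI (_ : 4 != 0 :> R)); rewrite ?pnatr_eq0 // /a /b; field: d2.
have dab : a - b = d by rewrite /a /b; field.
have := sum_bin_fib_expr sab pab p n; rewrite dab -/B => key.
apply: (mulfI (expf_neq0 (4 * p + 3) d0)); rewrite {}key.
(* One factor [d] matches the factor [a - b] on the right; the others cancel
   [(1 / d) ^+ (4 * p + 2)]. *)
have -> : d ^+ (4 * p + 3) = d * d ^+ (4 * p + 2) by rewrite addnS exprS.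
by rewrite -[RHS]mulrA [X in _ = d * X]mulrA -exprMn div1r divff // expr1n mul1r.
Qed.
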